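(* Let $d \ge 1$ and let $(x_n)_{n \in \mathbb{N}}$ be a sequence in $[0,1)^d$, regarded as the $d$-dimensional torus equipped with $\|\cdot\|_\infty$. Let $0 < \varepsilon < \tfrac{1}{d}$ and suppose that $D_N(x_n) = o(N^{-(1-\varepsilon)})$ as $N \to \infty$. Then $(x_n)_{n\in\mathbb{N}}$ has $\alpha$-pair correlations (with respect to $\|\cdot\|_\infty$) for every $\alpha$ with $0 < \alpha < \tfrac{1-\varepsilon}{d}$.
   Context: For $x \in \mathbb{R}$ let $\|x\|$ denote the distance of $x$ to the nearest integer, and for $x=(x_1,\ldots,x_d) \in \mathbb{R}^d$ put $\|x\|_\infty := \max(\|x_1\|,\ldots,\|x_d\|)$. Let $B(0,r)$ be the ball of radius $r$ around $0$ in the torus $[0,1)^d$ with respect to $\|\cdot\|_\infty$, and $\mathrm{vol}$ the Lebesgue volume. For $0<\alpha<\tfrac1d$ a sequence $(x_n)_{n\in\mathbb{N}}$ in $[0,1)^d$ has $\alpha$-pair correlations if for all $s>0$ $$\lim_{N\to\infty} \frac{1}{N^2}\, \frac{\#\{1 \le l \ne m \le N : \|x_l-x_m\|_\infty \le s N^{-\alpha}\}}{\mathrm{vol}(B(0,sN^{-\alpha}))} = 1,$$ where the pairs $(l,m)$ are ordered. The discrepancy of the first $N$ terms is $$D_N(x_n) := \sup_{B=[a,b) \subset [0,1)^d} \left| \tfrac{1}{N}\#\{1\le i\le N : x_i \in B\} - \lambda_d(B)\right|,$$ the supremum being over all axis-parallel half-open boxes $[a,b)=\prod_{i=1}^d [a_i,b_i)$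 contained in $[0,1)^d$, and $\lambda_d$ denoting Lebesgue measure. *)

(* Defs.v *)
From HB Require Import structures.
From mathcomp Require Import all_boot all_order all_algebra.
From mathcomp Require Import all_classical all_reals all_analysis.

Set Implicit Arguments.
Unset Strict Implicit.
Unset Printing Implicit Defensive.

Import Order.TTheory GRing.Theory Num.Theory.
Import numFieldNormedType.Exports.

Local Open Scope classical_set_scope.
Local Open Scope ring_scope.

Section lebesgue_measure_tuple.
Context {R : realType}.

Definition tcons n (p : R * n.-tuple R) : n.+1.-tuple R :=
  [tuple of p.1 :: p.2].

Lemma measurable_tcons n : measurable_fun setT (@tcons n).
Proof. exact: (measurable_cons measurable_fst measurable_snd). Qed.

(* [\x^] is the product measure of the library that only requires its left
   factor to be sigma-finite *)
Definition lebesgue_prod n (mu : {measure set (n.-tuple R) -> \bar R}) :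
    set (n.+1.-tuple R) -> \bar R :=
  pushforward (@lebesgue_measure R \x^ mu)%E (@tcons n).

Section lebesgue_prod_measure.
Variables (n : nat) (mu : {measure set (n.-tuple R) -> \bar R}).
Let mtcons := @measurable_tcons n.

Let lebesgue_prod0 : lebesgue_prod mu set0 = 0%E.
Proof. exact: measure0. Qed.

Let lebesgue_prod_ge0 A : (0 <= lebesgue_prod mu A)%E.
Proof. exact: measure_ge0. Qed.

Let lebesgue_prod_sigma_additive : semi_sigma_additive (lebesgue_prod mu).
Proof. exact: measure_semi_sigma_additive. Qed.

HB.instance Definition _ := isMeasure.Build _ _ _ (lebesgue_prod mu)
  lebesgue_prod0 lebesgue_prod_ge0 lebesgue_prod_sigma_additive.

End lebesgue_prod_measure.

(* Lebesgue measure on R^n, as the n-fold product of Lebesgue measure on R *)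
Fixpoint lebesgue_measure_tuple n : {measure set (n.-tuple R) -> \bar R} :=
  if n is m.+1 then lebesgue_prod (lebesgue_measure_tuple m) else \d_[tuple].

Lemma lebesgue_measure_tupleE n (A : 'I_n -> set R) :
  (forall i, measurable (A i)) ->
  lebesgue_measure_tuple n [set x | forall i, A i (tnth x i)] =
  (\prod_(i < n) lebesgue_measure (A i))%E.
Proof.
elim: n A => [|n IH] A mA.
  by rewrite big_ord0 /= diracE mem_set// => -[].
have mB : measurable [set x : n.-tuple R | forall i, A (lift ord0 i) (tnth x i)].
  rewrite [X in measurable X](_ : _ =
      \bigcap_(i in [set: 'I_n]) ((@tnth n R ^~ i) @^-1` A (lift ord0 i))).
    apply: fin_bigcap_measurable; first exact: finite_finset.
    by move=> i _; rewrite -[X in measurable X]setTI; exact: measurable_tnth.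
  by apply/seteqP; split => x /= xA i; [move=> _|]; exact: xA.
rewrite big_ord_recl -IH//= /lebesgue_prod /pushforward -product_measure2E//; last exact: mA.
congr product_measure2; apply/seteqP; split => -[u t] /=.
  by move=> utA; split=> [|i]; [exact: (utA ord0)|rewrite -(tnthS u); exact: utA].
move=> [uA tA] i; case: (unliftP ord0 i) => [j|] ->; first by rewrite tnthS.
by rewrite tnth0.
Qed.

End lebesgue_measure_tuple.

Section pair_correlations.
Context {R : realType}.
Variable d : nat.
Implicit Types (x : nat -> d.-tuple R) (a b u : d.-tuple R).

Definition vol (A : set (d.-tuple R)) : R := fine (lebesgue_measure_tuple d A).

Definition unit_cube : set (d.-tuple R) :=
  [set u | forall i, 0 <= tnth u i < 1].

Definition box a b : set (d.-tuple R) :=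
  [set u | forall i, tnth a i <= tnth u i < tnth b i].

Definition dist_int (t : R) : R := inf [set `|t - k%:~R| | k in [set: int]].

(* all terms are nonnegative, so that starting the maximum at 0 is harmless
   for 0 < d *)
Definition torus_norm u : R := \big[Num.max/0]_(i < d) dist_int (tnth u i).

Definition torus_ball (r : R) : set (d.-tuple R) :=
  [set u | unit_cube u /\ torus_norm u <= r].

(* the first N terms of a sequence x are x 0, ..., x N.-1 *)
Definition discrepancy x (N : nat) : R :=
  sup [set `|#|[pred i : 'I_N | x i \in box ab.1 ab.2]|%:R / N%:R
             - vol (box ab.1 ab.2)|
      | ab in [set ab | box ab.1 ab.2 `<=` unit_cube]].

Definition close_pairs x (N : nat) (r : R) : nat :=
  #|[pred lm : 'I_N * 'I_N | (lm.1 != lm.2) &&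
     (torus_norm [tuple tnth (x lm.1) i - tnth (x lm.2) i | i < d] <= r)]|.

Definition pair_correlations (alpha : R) x : Prop :=
  forall s : R, 0 < s ->
    (fun N => let r := s * N%:R `^ (- alpha) in
       (N%:R ^+ 2)^-1 * ((close_pairs x N r)%:R / vol (torus_ball r)))
    @ \oo --> (1 : R).

End pair_correlations.

(* Main.v *)
Require Import Defs.
From mathcomp Require Import all_boot all_order all_algebra.
From mathcomp Require Import all_classical all_reals all_analysis.
From mathcomp Require Import ring lra.
Import Order.TTheory GRing.Theory Num.Theory.
Import numFieldNormedType.Exports.
Local Open Scope classical_set_scope.
Local Open Scope ring_scope.

(** For a fixed centre [c] and radius [r < 1/2], the points at torus distance at
most [r] from [c] form a product of [d] arcs of length [2 * r].  Cut open at the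
integers, every arc falls into at most three intervals of [0, 1), so this
product is a disjoint union of [3 ^ d] axis-parallel boxes of total volume
[(2 * r) ^ d], and the number of the first [N] terms in it differs from
[N * (2 * r) ^ d] by at most [3 ^ d * N * D_N] ([close_count_discrepancy]).
Letting the centre run over the first [N] terms and taking away the [N] diagonal
pairs gives ([close_pairs_discrepancy])
  [| close_pairs + N - N ^ 2 (2 r) ^ d | <= 3 ^ d * N ^ 2 * D_N.]
The ball has volume [(2 * r) ^ d].  For [r = s N ^ (- alpha)] this is a constant
times [N ^ (- alpha d)], so after division by [N ^ 2 (2 r) ^ d] the error is of
order [(D_N + 1 / N) N ^ (alpha d)].  Both [D_N] and [1 / N] are at most
[N ^ (- (1 - eps))] for large [N], and [alpha * d < 1 - eps], so the error
tends to 0.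

The discrepancy speaks of half-open boxes while the ball is closed.  Half-open
arcs of radius [r] lie in the closed ones, which in turn lie in the half-open
arcs of any radius [t > r]; the resulting upper bound is continuous in [t], and
letting [t] decrease to [r] recovers the bound with [r] itself. *)

(** * Arcs of the circle as unions of intervals *)
Lemma dist_intE {R : realType} (t : R) :
  `|t| <= 1 -> dist_int t = Num.min `|t| (1 - `|t|).
Proof.
move=> t1; set S := [set `|t - k%:~R| | k in [set: int]].
have lbS : has_lbound S by exists 0 => _ [k _ <-]; exact: normr_ge0.
apply/eqP; rewrite eq_le; apply/andP; split; last first.
  apply: lb_le_inf => [|_ [k _ <-]]; first by exists `|t|; exists 0; rewrite ?subr0.
  have [->|k0] := eqVneq k 0; first by rewrite subr0 ge_min lexx.
  have : 1 <= `|k%:~R : R| by rewrite -intr_norm ler1z -gtz0_ge1 normr_gt0.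
  have := lerB_dist k%:~R t; rewrite distrC ge_min => tk k1.
  by apply/orP; right; lra.
rewrite le_min; apply/andP; split.
  by apply: ge_inf => //; exists 0; rewrite ?subr0.
apply: ge_inf => //; exists (if 0 <= t then 1 else -1) => //.
by case: ifPn => t0; [rewrite (ger0_norm t0)|rewrite (ltr0_norm (_ : t < 0)) ?ltNge//];
  [rewrite ler0_norm|rewrite ger0_norm]; move: t1; rewrite ler_norml; lra.
Qed.

(** [arc_lo c r k] and [arc_hi c r k] are the ends of the trace on [0, 1) of the
half-open arc of radius [r] around [c], translated by [k - 1], that is by -1, 0
or 1.  An empty trace shows up as [arc_hi c r k <= arc_lo c r k]. *)
Definition arc_lo {R : realType} (c r : R) (k : 'I_3) : R :=
  Num.max 0 (c - r + (k%:R - 1)).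
Definition arc_hi {R : realType} (c r : R) (k : 'I_3) : R :=
  Num.min 1 (c + r + (k%:R - 1)).
(** The pieces of an arc are disjoint for [r <= 1/2], so this is the indicator of
the arc; as a sum over the pieces it can be expanded in a product over the
coordinates, which is how the boxes arise. *)
Definition arc_count {R : realType} (c r y : R) : R :=
  \sum_(k < 3) (arc_lo c r k <= y < arc_hi c r k)%R%:R.

(** The translate by -1 can only meet [0, 1) near 0, and the translate by 1 only
near 1; this removes one of the two truncations in each outer piece. *)
Lemma big_arc {R : realType} (c r : R) (F : R -> R -> R) :
  0 <= c < 1 -> 0 < r <= 2^-1 ->
  \sum_(k < 3) F (arc_lo c r k) (arc_hi c r k) =
    F 0 (c + r - 1) + F (Num.max 0 (c - r)) (Num.min 1 (c + r)) + F (c - r + 1) 1.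
Proof.
move=> cI rI; rewrite !big_ord_recl big_ord0 /arc_lo /arc_hi /= addr0 addrA.
rewrite (_ : bump 0 0 = 1%N)// (_ : bump 0 1 = 2%N)//.
congr (F _ _ + F _ _ + F _ _).
- by apply/max_idPl; lra.
- by rewrite min_r ?sub0r//; lra.
- by rewrite subrr addr0.
- by rewrite subrr addr0.
- by rewrite max_r; lra.
- by rewrite min_l//; lra.
Qed.

Lemma arc_length {R : realType} (c r : R) : 0 <= c < 1 -> 0 < r <= 2^-1 ->
  \sum_(k < 3) Num.max 0 (arc_hi c r k - arc_lo c r k) = 2 * r.
Proof.
move=> cI rI; rewrite (big_arc _ _ (fun a b => Num.max 0 (b - a)))//.
case: (lerP 0 (c - r)) => ?; case: (lerP 1 (c + r)) => ?;
by repeat (case: (lerP 0 _) => ?; try lra).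
Qed.

Lemma arc_countE {R : realType} (c r y : R) :
  0 <= c < 1 -> 0 < r <= 2^-1 -> 0 <= y < 1 ->
  arc_count c r y = (y < c + r - 1)%R%:R + (c - r <= y < c + r)%R%:R
                    + (c - r + 1 <= y)%R%:R.
Proof.
move=> cI rI /andP[y0 y1].
rewrite /arc_count (big_arc _ _ (fun a b => (a <= y < b)%R%:R))//.
by rewrite lt_min ge_max y0 y1 andbT.
Qed.

(** Half-open arcs of radius [r] lie in the closed ones, and their pieces do not
overlap: the bound by 1 is where [r < 1/2] enters. *)
Lemma arc_count_le {R : realType} (c r y : R) :
  0 <= c < 1 -> 0 <= y < 1 -> 0 < r < 2^-1 ->
  arc_count c r y <= (dist_int (c - y) <= r)%R%:R.
Proof.
move=> cI yI rI; rewrite dist_intE ?ler_norml; last lra.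
rewrite arc_countE ?ge_min; try lra.
have [cy|cy] := lerP 0 (c - y); [rewrite (ger0_norm cy)|rewrite (ltr0_norm cy)].
all: case: (ltrP y (c + r - 1)) => ?; case: (lerP (c - r) y) => ?; try lra.
all: case: (ltrP y (c + r)) => ?; case: (lerP (c - r + 1) y) => ?; try lra.
all: case: (lerP _ r) => ? /=; try lra.
all: case: (lerP _ r) => ? /=; lra.
Qed.

(** The passage to a larger radius compensates for the end point missing from a
half-open arc. *)
Lemma arc_count_ge {R : realType} (c r r' y : R) :
  0 <= c < 1 -> 0 <= y < 1 -> 0 < r < r' -> r' <= 2^-1 ->
  (dist_int (c - y) <= r)%R%:R <= arc_count c r' y.
Proof.
move=> cI yI rI r'I; rewrite dist_intE ?ler_norml; last lra.
rewrite arc_countE ?ge_min; try lra.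
have [cy|cy] := lerP 0 (c - y); [rewrite (ger0_norm cy)|rewrite (ltr0_norm cy)].
all: case: (ltrP y (c + r' - 1)) => ?; case: (lerP (c - r') y) => ?; try lra.
all: case: (ltrP y (c + r')) => ?; case: (lerP (c - r' + 1) y) => ?; try lra.
all: case: (lerP _ r) => ? /=; try lra.
all: case: (lerP _ r) => ? /=; lra.
Qed.

(** * Volumes of boxes and balls *)
Lemma vol_cartesian {R : realType} {d : nat} (A : 'I_d -> set R) (l : 'I_d -> R) :
  (forall i, measurable (A i)) -> (forall i, lebesgue_measure (A i) = (l i)%:E) ->
  vol [set u : d.-tuple R | forall i, A i (tnth u i)] = \prod_(i < d) l i.
Proof.
move=> mA lA; rewrite /vol lebesgue_measure_tupleE//.
by rewrite (eq_bigr (fun i => (l i)%:E))// prodEFin.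
Qed.

Lemma vol_box {R : realType} {d : nat} (a b : d.-tuple R) :
  vol (box a b) = \prod_(i < d) Num.max 0 (tnth b i - tnth a i).
Proof.
rewrite -(vol_cartesian (fun i => `[tnth a i, tnth b i[%classic))//.
move=> i; rewrite lebesgue_measure_itv/= lte_fin.
case: ltrP => ab; first by rewrite max_r ?subr_ge0 ?ltW.
by rewrite max_l ?subr_le0.
Qed.

(** This serves to see that the set whose supremum defines the discrepancy is
bounded above. *)
Lemma vol_box_unit_cube {R : realType} {d : nat} (a b : d.-tuple R) :
  box a b `<=` @unit_cube R d -> 0 <= vol (box a b) <= 1.
Proof.
move=> ab; rewrite vol_box prodr_ge0/=; last by move=> i _; rewrite le_max lexx.
have [ltab|] := boolP [forall i, tnth a i < tnth b i]; last first.
  rewrite negb_forall => /existsP[i]; rewrite -leNgt => ba.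
  by rewrite (bigD1 i)//= max_l ?subr_le0// mul0r.
move/forallP in ltab; apply: prodr_ile1 => i _; rewrite le_max lexx ge_max ler01/=.
have /ab/(_ i) : box a b a by move=> j /=; rewrite lexx ltab.
suff : tnth b i <= 1 by lra.
rewrite leNgt; apply/negP => b1.
(* if [b i > 1], the corner [a] raised to 1 in such coordinates is in the box
   but not in the unit cube *)
have /ab/(_ i) : box a b [tuple Num.max (tnth a j)
    (if 1 < tnth b j then 1 else tnth a j) | j < d].
  move=> j /=; rewrite tnth_mktuple le_max lexx/= gt_max ltab/=.
  by case: ifPn => // _; exact: ltab.
by rewrite tnth_mktuple b1 gt_max ltxx !andbF.
Qed.

Lemma torus_norm_leE {R : realType} {d : nat} (u : d.-tuple R) (r : R) : 0 <= r ->
  (torus_norm u <= r) = [forall i, dist_int (tnth u i) <= r].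
Proof.
move=> r0; apply/bigmax_leP/forallP => [[_ +] i|ur]; first exact.
by split.
Qed.

(** Seen in [0, 1), the arc of radius [r] around 0 is the union of [0, r] and
[1 - r, 1). *)
Lemma vol_torus_ball {R : realType} {d : nat} (r : R) : 0 < r < 2^-1 ->
  vol (torus_ball r : set (d.-tuple R)) = (2 * r) ^+ d.
Proof.
move=> rI; rewrite -[d in RHS]card_ord -prodr_const.
rewrite -(vol_cartesian (fun=> `[0, r]%classic `|` `[1 - r, 1[%classic)).
- congr vol; apply/seteqP; split => u /=.
    move=> [u01]; rewrite torus_norm_leE; last lra.
    move=> /forallP/= ur i; have ui := u01 i; have := ur i.
    rewrite dist_intE ger0_norm; try lra.
    by rewrite ge_min !in_itv/= => /orP[]?; [left|right]; lra.
  move=> ur; have u01 : unit_cube u.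
    by move=> i; have := ur i; rewrite !in_itv/= => -[]; lra.
  split=> //; rewrite torus_norm_leE; last lra.
  apply/forallP => i; have := u01 i; have := ur i; rewrite !in_itv/= => uri ui.
  rewrite dist_intE ger0_norm; try lra.
  by rewrite ge_min; apply/orP; case: uri => ?; [left|right]; lra.
- by move=> _; exact: measurableU.
move=> _; transitivity
  (lebesgue_measure `[0%R, r]%classic + lebesgue_measure `[(1 - r)%R, 1%R[%classic)%E.
  apply: measureU => //; apply/seteqP; split => // t /=.
  by rewrite !in_itv/= => -[]; lra.
have [r0 r1] : 0 < r /\ 1 - r < 1 by lra.
rewrite !lebesgue_measure_itv/= !lte_fin r0 r1.
by rewrite -!EFinB -EFinD; congr EFin; lra.
Qed.

(** * Counting close pairs *)
Lemma prod_bool {R : comNzRingType} {n : nat} (P : pred 'I_n) :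
  \prod_(i < n) (P i)%:R = [forall i, P i]%:R :> R.
Proof.
case: forallP => [Pi|nP]; first by rewrite big1// => i _; rewrite Pi.
have [i /negbTE nPi] : exists i, ~~ P i.
  by apply/existsP; rewrite -negb_forall; apply/negP => /forallP.
by rewrite (bigD1 i)//= nPi mul0r.
Qed.

Lemma box_discrepancy {R : realType} {d N : nat} (x : nat -> d.-tuple R)
    (a b : d.-tuple R) : (0 < N)%N -> box a b `<=` @unit_cube R d ->
  `|\sum_(m < N) \prod_(i < d) (tnth a i <= tnth (x m) i < tnth b i)%R%:R
    - N%:R * \prod_(i < d) Num.max 0 (tnth b i - tnth a i)|
  <= N%:R * discrepancy x N.
Proof.
move=> N0 ab; have NR : 0 < N%:R :> R by rewrite ltr0n.
rewrite -vol_box.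
rewrite -ler_pdivrMl// -[X in X * _]gtr0_norm ?invr_gt0// -normrM mulrBr mulKf ?gt_eqF//.
rewrite mulrC.
apply: ub_le_sup; last first.
  exists (a, b) => //=; congr `|_ / _ - _|.
  rewrite -sum1_card natr_sum big_mkcond/=; apply: eq_bigr => m _.
  rewrite prod_bool inE; case: forallP => xm; last by case: ifPn => //; rewrite inE.
  by rewrite mem_set.
exists 2 => _ [[a' b']/= a'b' <-].
have := vol_box_unit_cube _ _ a'b'.
set c : R := _ / _; have : 0 <= c <= 1.
  rewrite divr_ge0 ?ler0n//= ler_pdivrMr// mul1r ler_nat.
  by rewrite -[leqRHS]card_ord max_card.
by rewrite ler_norml; lra.
Qed.

(** Expanding the product over the coordinates of sums over the three pieces
turns both the count and the volume [(2 * r) ^ d] into sums over the [3 ^ d]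
boxes, one for each choice of a piece per coordinate; the discrepancy bounds the
error box by box. *)
Lemma arc_product_discrepancy {R : realType} {d N : nat} (x : nat -> d.-tuple R)
    (c : d.-tuple R) (r : R) : (0 < N)%N -> unit_cube c -> 0 < r <= 2^-1 ->
  `|\sum_(m < N) \prod_(i < d) arc_count (tnth c i) r (tnth (x m) i)
    - N%:R * (2 * r) ^+ d| <= 3 ^+ d * (N%:R * discrepancy x N).
Proof.
move=> N0 cI rI.
under eq_bigr do rewrite bigA_distr_bigA.
rewrite exchange_big/= -[d in (2 * r) ^+ d]card_ord -prodr_const.
rewrite (eq_bigr _ (fun i _ => esym (arc_length _ _ (cI i) rI))).
rewrite bigA_distr_bigA mulr_sumr -sumrB.
apply: le_trans (ler_norm_sum _ _ _) _.
have -> : 3 ^+ d = #|{ffun 'I_d -> 'I_3}|%:R :> R by rewrite card_ffun !card_ord natrX.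
rewrite mulr_natl -sumr_const; apply: ler_sum => f _.
set a := [tuple arc_lo (tnth c i) r (f i) | i < d].
set b := [tuple arc_hi (tnth c i) r (f i) | i < d].
have ab : box a b `<=` @unit_cube R d.
  move=> u uab i; have := uab i.
  by rewrite !tnth_mktuple ge_max lt_min; lra.
have := box_discrepancy x a b N0 ab.
congr (is_true (`|_ - _ * _| <= _)).
  by apply: eq_bigr => m _; apply: eq_bigr => i _; rewrite !tnth_mktuple.
by apply: eq_bigr => i _; rewrite !tnth_mktuple.
Qed.

Lemma torus_norm_sub_le_prod {R : realType} {d : nat} (u v : d.-tuple R) (r : R) : 0 <= r ->
  (torus_norm [tuple tnth u i - tnth v i | i < d] <= r)%R%:R =
  \prod_(i < d) (dist_int (tnth u i - tnth v i) <= r)%R%:R :> R.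
Proof.
move=> r0; rewrite torus_norm_leE// prod_bool.
by under eq_forallb do rewrite tnth_mktuple.
Qed.

(** The lower bound comes from the arcs of radius [r], the upper bound from those
of radius [t > r] in the limit where [t] decreases to [r]. *)
Lemma close_count_discrepancy {R : realType} {d N : nat} (x : nat -> d.-tuple R)
    (c : d.-tuple R) (r : R) : (forall n, unit_cube (x n)) -> (0 < N)%N ->
  unit_cube c -> 0 < r < 2^-1 ->
  `|\sum_(m < N) (torus_norm [tuple tnth c i - tnth (x m) i | i < d] <= r)%R%:R
    - N%:R * (2 * r) ^+ d| <= 3 ^+ d * (N%:R * discrepancy x N).
Proof.
move=> xI N0 cI rI.
have r0 : 0 <= r by lra.
under eq_bigr do rewrite torus_norm_sub_le_prod//.
rewrite ler_distl; apply/andP; split.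
  have rI' : 0 < r <= 2^-1 by lra.
  have := arc_product_discrepancy x c r N0 cI rI'.
  rewrite ler_distl => /andP[+ _] => /le_trans; apply.
  apply: ler_sum => m _; apply: ler_prod => i _.
  rewrite arc_count_le ?andbT//; last exact: xI.
  by apply: sumr_ge0 => k _; exact: ler0n.
set C := 3 ^+ d * _.
have : N%:R * (2 * t) ^+ d + C @[t --> r^'+] --> N%:R * (2 * r) ^+ d + C.
  apply: cvg_at_right_filter; apply: cvgD; last exact: cvg_cst.
  apply: cvgMr; apply: (@cvg_comp _ _ _ (fun t : R => 2 * t) (fun t => t ^+ d)).
    by apply: cvgMr; exact: cvg_id.
  exact: exprn_continuous.
move/cvgr_to_ge; apply.
near=> t.
have rt : r < t by [].
have tI : 0 < t <= 2^-1.
  have : t <= 2^-1 by near: t; apply: nbhs_right_le; lra.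
  lra.
have := arc_product_discrepancy x c t N0 cI tI.
rewrite ler_distl => /andP[_]; apply: le_trans.
apply: ler_sum => m _; apply: ler_prod => i _.
by rewrite ler0n arc_count_ge//; [exact: xI|lra|lra].
Unshelve. all: by end_near.
Qed.

(** Every index is close to itself, so adding [N] to the number of close pairs
makes it a sum over all centres of the counts around each of them. *)
Lemma close_pairs_discrepancy {R : realType} {d N : nat} (x : nat -> d.-tuple R)
    (r : R) : (forall n, unit_cube (x n)) -> (0 < N)%N -> 0 < r < 2^-1 ->
  `|(close_pairs x N r)%:R + N%:R - N%:R ^+ 2 * (2 * r) ^+ d|
  <= 3 ^+ d * (N%:R ^+ 2 * discrepancy x N).
Proof.
move=> xI N0 rI.
pose close (l m : 'I_N) :=
  (torus_norm [tuple tnth (x l) i - tnth (x m) i | i < d] <= r)%R.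
have -> : (close_pairs x N r)%:R + N%:R = \sum_(l < N) \sum_(m < N) (close l m)%:R :> R.
  have closexx l : close l l.
    rewrite /close torus_norm_leE; last lra.
    apply/forallP => i; rewrite tnth_mktuple subrr dist_intE normr0// ge_min; lra.
  rewrite /close_pairs -sum1_card natr_sum big_mkcond/=.
  rewrite -(pair_bigA _ (fun l m => if (l != m) && close l m then 1 else 0))/=.
  rewrite -[X in _ + X%:R]card_ord -sum1_card natr_sum -big_split/=.
  apply: eq_bigr => l _; rewrite (bigD1 l)//= eqxx/= add0r addrC.
  rewrite [RHS](bigD1 l)//= closexx; congr (_ + _); apply: eq_bigr => m ml.
  by rewrite eq_sym ml; case: (close l m).
have -> : N%:R ^+ 2 * (2 * r) ^+ d = \sum_(l < N) N%:R * (2 * r) ^+ d :> R.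
  by rewrite sumr_const card_ord -[RHS]mulr_natl; ring.
rewrite -sumrB; apply: le_trans (ler_norm_sum _ _ _) _.
have -> : 3 ^+ d * (N%:R ^+ 2 * discrepancy x N) =
    \sum_(l < N) 3 ^+ d * (N%:R * discrepancy x N).
  by rewrite sumr_const card_ord -[RHS]mulr_natl; ring.
by apply: ler_sum => l _; exact: close_count_discrepancy.
Qed.

(** * Asymptotics *)
Lemma cvg_powRN_infty {R : realType} (b : R) : 0 < b ->
  N%:R `^ (- b) @[N --> \oo] --> (0 : R).
Proof.
move=> b0; apply/cvgrPdist_le => e e0.
near=> N.
have eN : e^-1 `^ b^-1 <= N%:R.
  by near: N; exact: nbhs_infty_ger.
have N0 : 0 < N%:R :> R by apply: lt_le_trans eN; rewrite powR_gt0// invr_gt0.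
rewrite sub0r normrN ger0_norm ?powR_ge0// powRN -[leRHS]invrK lef_pV2 ?posrE ?powR_gt0 ?invr_gt0//.
have := ge0_ler_powR (ltW b0) (powR_ge0 _ _) (ltW N0) eN.
by rewrite -powRrM mulVf ?gt_eqF// powRr1// ltW// invr_gt0.
Unshelve. all: by end_near.
Qed.

Theorem theorem1p1 (R : realType) (d : nat) (hd : (1 <= d)%N)
    (x : nat -> d.-tuple R) (hx : forall n, unit_cube (x n))
    (eps : R) (eps_gt0 : 0 < eps) (eps_lt : eps < d%:R^-1)
    (hD : discrepancy x =o_\oo (fun N : nat => N%:R `^ (- (1 - eps)) : R))
    (alpha : R) (alpha_gt0 : 0 < alpha) (alpha_lt : alpha < (1 - eps) / d%:R) :
  pair_correlations alpha x.
Proof.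
move=> s s0 /=.
have d0 : 0 < d%:R :> R by rewrite ltr0n.
pose b : R := 1 - eps - alpha * d%:R.
have b0 : 0 < b by rewrite subr_gt0 -ltr_pdivlMr.
pose K : R := (3 ^+ d + 1) / (2 * s) ^+ d.
have K0 : 0 < (2 * s) ^+ d by rewrite exprn_gt0// mulr_gt0.
have bound : \forall N \near \oo,
    `|1 - (N%:R ^+ 2)^-1 * ((close_pairs x N (s * N%:R `^ (- alpha)))%:R /
       vol (torus_ball (s * N%:R `^ (- alpha)) : set (d.-tuple R)))|
    <= K * N%:R `^ (- b).
  have /cvgrPdist_lt/(_ (s^-1 / 2)) small := cvg_powRN_infty _ alpha_gt0.
  near=> N.
  have N0 : (0 < N)%N by near: N; exact: nbhs_infty_gt.
  have NR : 0 < N%:R :> R by rewrite ltr0n.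
  set r := s * _.
  have rI : 0 < r < 2^-1.
    rewrite mulr_gt0 ?powR_gt0//= -[ltRHS](mulVKf (lt0r_neq0 s0)) ltr_pM2l//.
    have : `|0 - N%:R `^ (- alpha)| < s^-1 / 2.
      by near: N; apply: small; rewrite divr_gt0// invr_gt0.
    by rewrite sub0r normrN ger0_norm ?powR_ge0.
  (* domination with the constant 1 is enough: the strict inequality
     between the exponents provides the decay *)
  have DN : discrepancy x N <= N%:R `^ (- (1 - eps)).
    apply: le_trans (ler_norm _) _.
    rewrite -[leRHS]ger0_norm ?powR_ge0// -[leRHS]mul1r.
    by near: N; have /eqoP := hD; apply.
  have VE : (2 * r) ^+ d = (2 * s) ^+ d * N%:R `^ (- (alpha * d%:R)).
    by rewrite mulrA exprMn -mulNr powRrM powR_mulrn ?powR_ge0.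
  have V0 : 0 < (2 * r) ^+ d by rewrite exprn_gt0//; lra.
  rewrite vol_torus_ball//.
  have -> : K * N%:R `^ (- b) =
      (3 ^+ d + 1) * N%:R `^ (- (1 - eps)) / (2 * r) ^+ d.
    rewrite VE (_ : - (1 - eps) = - b + - (alpha * d%:R)); last by rewrite /b; ring.
    rewrite powRD ?(gt_eqF NR) ?implybT//.
    by rewrite /K; field; rewrite !lt0r_neq0// powR_gt0.
  rewrite ler_pdivlMr// -{2}(gtr0_norm V0) -normrM.
  rewrite -(ler_pM2l (exprn_gt0 2 NR)) -{1}(gtr0_norm (exprn_gt0 2 NR)) -normrM.
  rewrite (_ : _ * (_ * _) = N%:R ^+ 2 * (2 * r) ^+ d - (close_pairs x N r)%:R); last first.
    by field; rewrite !gt_eqF// exprn_gt0//; lra.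
  have := close_pairs_discrepancy x r hx N0 rI.
  set V := (2 * r) ^+ d; set cp := (close_pairs x N r)%:R.
  have N1 : N%:R^-1 <= N%:R `^ (- (1 - eps)).
    rewrite -(powR_inv1 (ltW NR)) ler_powR ?ler1n//.
    lra.
  have N2 : N%:R <= N%:R ^+ 2 * N%:R `^ (- (1 - eps)).
    by rewrite expr2 -mulrA ler_peMr// -ler_pdivrMl// mulr1.
  move=> cpD.
  have -> : N%:R ^+ 2 * V - cp = N%:R - (cp + N%:R - N%:R ^+ 2 * V) by ring.
  apply: le_trans (ler_normB _ _) _.
  rewrite (ger0_norm (ltW NR)) mulrA mulrDr mulr1 mulrDl addrC lerD//.
  apply: le_trans cpD _; rewrite mulrCA mulrA ler_wpM2l// mulr_ge0// exprn_ge0//.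
have Kb : K * N%:R `^ (- b) @[N --> \oo] --> 0.
  by rewrite -(mulr0 K); apply: cvgMr; exact: cvg_powRN_infty.
apply/cvgrPdist_le => e e0; near=> N.
apply: (@le_trans _ _ (K * N%:R `^ (- b))); first by near: N.
near: N; have /cvgrPdist_le/(_ e e0) := Kb.
by apply: filterS => N; rewrite sub0r normrN; apply: le_trans; exact: ler_norm.
Unshelve. all: by end_near.
Qed.
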